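(* Let $F$ be a nonempty index set, and for each $\alpha\in F$ let $A_\alpha$ be a commutative ring with unity, $\Lambda_\alpha$ a nonempty set and $\psi_\alpha: A_\alpha\to\mathcal{P}(\Lambda_\alpha)$ a semi-transition map. Suppose there exists a fixed positive integer $m$ such that for every $\alpha\in F$ and all $a_\alpha,b_\alpha\in A_\alpha$, $\psi_\alpha(a_\alpha)\cap\psi_\alpha(b_\alpha)=\emptyset$ implies that the ideal $(a_\alpha^m,b_\alpha^m)$ of $A_\alpha$ is principal. Then the product ring $\prod_{\alpha\in F}A_\alpha$ is a semi-transitional ring.
   Context: All rings are commutative with unity. $\mathcal{P}(\Lambda)$ is the power set of $\Lambda$. For a ring $A$ and a nonempty set $\Lambda$, a map $\psi:A\to\mathcal{P}(\Lambda)$ is a semi-transition map on $A$ if: (i) $\psi(ab)=\psi(a)\cup\psi(b)$ for all $a,b\in A$; (ii) $\psi(1)=\emptyset$, and $\psi(a)=\Lambda$ if and only if $a=0$; (iii) for all $a,b\in A$ there is some $c$ in the ideal $(a,b)$ with $\psi(a)\cap\psi(b)=\psi(c)\subseteq\psi(a+b)$; moreover, if $\psi(a)\cap\psi(b)=\emptyset$, then the ideal $(a^m,b^n)$ is principal for some $m,n\in\mathbb{N}$ (positive integers). A ring $A$ is semi-transitional if there exist a nonempty set $\Lambda$ and a semi-transition map $A\to\mathcal{P}(\Lambda)$. *)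

(* Defs.v *)
From HB Require Import structures.
From mathcomp Require Import all_boot all_algebra.
From mathcomp Require Import boolp classical_sets.

Set Implicit Arguments.
Unset Strict Implicit.
Unset Printing Implicit Defensive.

Import GRing.Theory.
Local Open Scope ring_scope.
Local Open Scope classical_set_scope.

(* A named alias, so that the pointwise ring structure does not compete with
   the other canonical structures on (dependent) function types. *)
Definition ring_prod (F : Type) (A : F -> comPzRingType) : Type :=
  forall alpha : F, A alpha.

Section RingProd.
Variables (F : Type) (A : F -> comPzRingType).
Implicit Types a b c : ring_prod A.

HB.instance Definition _ := gen_eqMixin (ring_prod A).
HB.instance Definition _ := gen_choiceMixin (ring_prod A).

Definition ring_prod_zero : ring_prod A := fun=> 0.
Definition ring_prod_one : ring_prod A := fun=> 1.
Definition ring_prod_opp a : ring_prod A := fun alpha => - a alpha.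
Definition ring_prod_add a b : ring_prod A := fun alpha => a alpha + b alpha.
Definition ring_prod_mul a b : ring_prod A := fun alpha => a alpha * b alpha.

Fact ring_prod_addA : associative ring_prod_add.
Proof. by move=> a b c; apply: functional_extensionality_dep => i; apply: addrA. Qed.
Fact ring_prod_addC : commutative ring_prod_add.
Proof. by move=> a b; apply: functional_extensionality_dep => i; apply: addrC. Qed.
Fact ring_prod_add0 : left_id ring_prod_zero ring_prod_add.
Proof. by move=> a; apply: functional_extensionality_dep => i; apply: add0r. Qed.
Fact ring_prod_addN : left_inverse ring_prod_zero ring_prod_opp ring_prod_add.
Proof. by move=> a; apply: functional_extensionality_dep => i; apply: addNr. Qed.

HB.instance Definition _ := GRing.isZmodule.Build (ring_prod A)
  ring_prod_addA ring_prod_addC ring_prod_add0 ring_prod_addN.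

Fact ring_prod_mulA : associative ring_prod_mul.
Proof. by move=> a b c; apply: functional_extensionality_dep => i; apply: mulrA. Qed.
Fact ring_prod_mulC : commutative ring_prod_mul.
Proof. by move=> a b; apply: functional_extensionality_dep => i; apply: mulrC. Qed.
Fact ring_prod_mul1 : left_id ring_prod_one ring_prod_mul.
Proof. by move=> a; apply: functional_extensionality_dep => i; apply: mul1r. Qed.
Fact ring_prod_mulDl : left_distributive ring_prod_mul ring_prod_add.
Proof. by move=> a b c; apply: functional_extensionality_dep => i; apply: mulrDl. Qed.

HB.instance Definition _ := GRing.Zmodule_isComPzRing.Build (ring_prod A)
  ring_prod_mulA ring_prod_mulC ring_prod_mul1 ring_prod_mulDl.

End RingProd.

Definition ideal1 (A : comPzRingType) (a : A) : set A :=
  [set x | exists r, x = r * a].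

Definition ideal2 (A : comPzRingType) (a b : A) : set A :=
  [set x | exists r s, x = r * a + s * b].

Definition principal (A : comPzRingType) (I : set A) : Prop :=
  exists d, I = ideal1 d.

(* The zero ring is a [comPzRingType], but admits no such map once [Lambda] is
   inhabited: psi 1 = set0 and psi 0 = setT would then be incompatible. *)
Record semi_transition_map (A : comPzRingType) (Lambda : Type)
    (psi : A -> set Lambda) : Prop := SemiTransitionMap {
  semi_transitionM : forall a b, psi (a * b) = psi a `|` psi b;
  semi_transition1 : psi 1 = set0;
  semi_transitionT : forall a, psi a = setT <-> a = 0;
  semi_transitionI : forall a b, exists c,
    [/\ ideal2 a b c, psi a `&` psi b = psi c & psi c `<=` psi (a + b)];
  semi_transition_principal : forall a b, psi a `&` psi b = set0 ->
    exists m n : nat,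
      [/\ (0 < m)%N, (0 < n)%N & principal (ideal2 (a ^+ m) (b ^+ n))]
}.

Definition semi_transitional (A : comPzRingType) : Prop :=
  exists (Lambda : Type) (psi : A -> set Lambda),
    inhabited Lambda /\ semi_transition_map psi.

(* Main.v *)
(** On the disjoint union of the [Lambda alpha], take [psi a] to be the
    disjoint union of the sets [psi alpha (a alpha)].  Membership in an ideal
    with one or two generators is tested coordinatewise, so every axiom follows
    from those of the [psi alpha] by choosing witnesses in each coordinate; the
    uniform exponent [m] is what makes the coordinatewise generators of
    [(a alpha ^ m, b alpha ^ m)] assemble into one for [(a ^ m, b ^ m)]. *)
Require Import Defs.
From mathcomp Require Import all_boot all_algebra.
From mathcomp Require Import boolp classical_sets.

Import GRing.Theory.
Local Open Scope ring_scope.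
Local Open Scope classical_set_scope.

(** Classical choice via [cid]: witnesses found separately in each coordinate become one element of
    the product. *)
Lemma dependent_function_choice (I : Type) (T : I -> Type)
    (P : forall i, T i -> Prop) :
  (forall i, exists x, P i x) -> exists f : forall i, T i, forall i, P i (f i).
Proof. by move=> h; exists (fun i => sval (cid (h i))) => i; case: cid. Qed.

Section CoordinatewiseIdeals.
Variables (F : Type) (A : F -> comPzRingType).
Implicit Types a b c d : ring_prod A.

Lemma ring_prod_exp a n alpha : (a ^+ n) alpha = a alpha ^+ n.
Proof.
elim: n => [|n IHn]; first by rewrite !expr0.
by rewrite !exprS -IHn.
Qed.

Lemma ring_prod_ideal1 c d :
  ideal1 d c <-> forall alpha, ideal1 (d alpha) (c alpha).
Proof.
split=> [[r ->] alpha|/dependent_function_choice[r rP]].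
  by exists (r alpha).
by exists r; apply: functional_extensionality_dep.
Qed.

(** The two coefficients can be chosen independently in each coordinate, so [F] may be infinite. *)
Lemma ring_prod_ideal2 a b c :
  ideal2 a b c <-> forall alpha, ideal2 (a alpha) (b alpha) (c alpha).
Proof.
split=> [[r [s ->]] alpha|].
  by exists (r alpha), (s alpha).
move=> /dependent_function_choice[r] /dependent_function_choice[s rsP].
by exists r, s; apply: functional_extensionality_dep.
Qed.

Lemma ring_prod_principal a b :
  (forall alpha, principal (ideal2 (a alpha) (b alpha))) ->
  principal (ideal2 a b).
Proof.
move=> /dependent_function_choice[d dP]; exists (d : ring_prod A).
apply/seteqP; split=> c.
  by move=> /ring_prod_ideal2 cP; apply/ring_prod_ideal1 => alpha; rewrite -dP.
by move=> /ring_prod_ideal1 cP; apply/ring_prod_ideal2 => alpha; rewrite dP.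
Qed.

End CoordinatewiseIdeals.

Theorem theorem2p4 (F : Type) (A : F -> comPzRingType) (Lambda : F -> Type)
    (psi : forall alpha : F, A alpha -> set (Lambda alpha)) :
  inhabited F ->
  (forall alpha : F, inhabited (Lambda alpha)) ->
  (forall alpha : F, semi_transition_map (psi alpha)) ->
  (exists m : nat, (0 < m)%N /\
     forall (alpha : F) (a b : A alpha),
       psi alpha a `&` psi alpha b = set0 ->
       principal (ideal2 (a ^+ m) (b ^+ m))) ->
  semi_transitional (ring_prod A).
Proof.
move=> [alpha0] Lambda_inh psiP [m [m_gt0 mP]].
exists {alpha : F & Lambda alpha}.
exists (fun (a : ring_prod A) p => psi (projT1 p) (a (projT1 p)) (projT2 p)).
split; first by case: (Lambda_inh alpha0) => l; split; exists alpha0.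
split.
- move=> a b; apply/funext => -[alpha l] /=.
  (* Set operations are pointwise, so the axiom for [psi alpha] evaluated at [l] is convertible to
     the goal. *)
  exact: (congr1 (@^~ l) (semi_transitionM (psiP alpha) _ _)).
- apply/funext => -[alpha l] /=.
  exact: (congr1 (@^~ l) (semi_transition1 (psiP alpha))).
- move=> a; split=> [aT|->].
    apply: functional_extensionality_dep => alpha.
    (* If the disjoint union is full, so is its fibre over each [alpha], which forces
       [a alpha = 0]. *)
    apply/(semi_transitionT (psiP alpha))/seteqP; split=> // l _.
    by have /= -> := congr1 (@^~ (existT _ alpha l)) aT.
  apply/funext => -[alpha l] /=.
  exact: (congr1 (@^~ l) (proj2 (semi_transitionT (psiP alpha) 0) erefl)).
- move=> a b.
  have /dependent_function_choice[c cP] alpha :=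
    semi_transitionI (psiP alpha) (a alpha) (b alpha).
  exists c; split.
  + by apply/ring_prod_ideal2 => alpha; case: (cP alpha).
  + apply/funext => -[alpha l] /=.
    by have [_ <- _] := cP alpha.
  + by move=> [alpha l] /=; have [_ _] := cP alpha; apply.
- move=> a b ab0; exists m, m; split=> //.
  apply: ring_prod_principal => alpha; rewrite !ring_prod_exp.
  apply: mP; apply/seteqP; split=> // l abl.
  (* Both empty sets unfold to [False]; moving to the point over [alpha] lets [ab0] apply. *)
  by rewrite -[set0 l]/(set0 (existT _ alpha l)) -ab0.
Qed.
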